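(* Let $n=2$. Let $V^1,V^2:\mathbb{T}\to[0,\infty)$ be continuous functions such that, for $i=1,2$, $\{V^i=0\}=\{y_{0i}\}$ for some $y_{0i}\in\mathbb{T}$. Define $V_1(\xi_1,\xi_2)=V^1(\xi_1)$ and $V_2(\xi_1,\xi_2)=V^2(\xi_2)$ for $(\xi_1,\xi_2)\in\mathbb{T}^2$, and let $H_i(\xi,p)=|p|^2-V_i(\xi)$ for $i=1,2$. Then there exists $\gamma>0$ such that $\overline{H}(P)=0$ for all $P\in\mathbb{R}^2$ with $|P|\le\gamma$.
   Context: $\mathbb{T}=\mathbb{R}/\mathbb{Z}$, $\mathbb{T}^2=\mathbb{R}^2/\mathbb{Z}^2$, and functions on the torus are identified with periodic functions. Effective Hamiltonian: for each $P\in\mathbb{R}^2$ it is known that there is a unique constant $\overline{H}(P)$ such that the cell problem $$H_1(\xi,P+Dv_1(\xi))+v_1(\xi)-v_2(\xi)=\overline{H}(P),\qquad H_2(\xi,P+Dv_2(\xi))+v_2(\xi)-v_1(\xi)=\overline{H}(P)\quad\text{in }\mathbb{T}^2$$ admits a continuous viscosity solution $(v_1,v_2)\in C(\mathbb{T}^2)^2$ (viscosity inequalities are imposed on each component with the other component inserted as a given function). *)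

(* Defs.v *)
From HB Require Import structures.
From mathcomp Require Import all_boot all_order all_algebra.
From mathcomp Require Import all_classical all_reals all_analysis.
Set Implicit Arguments.
Unset Strict Implicit.
Unset Printing Implicit Defensive.
Import Order.TTheory GRing.Theory Num.Theory.
Import numFieldNormedType.Exports.
Local Open Scope classical_set_scope.
Local Open Scope ring_scope.

Section WeaklyCoupledCellProblem.
Context {R : realType} {n : nat}.

(* The library norm on 'rV[R]_n is the sup norm. *)
Definition enorm (p : 'rV[R]_n) : R := Num.sqrt (\sum_(i < n) p 0 i ^+ 2).

Definition gradient (phi : 'rV[R]_n -> R) (x : 'rV[R]_n) : 'rV[R]_n :=
  \row_(i < n) 'D_(delta_mx 0 i) phi x.

Definition C1 (phi : 'rV[R]_n -> R) : Prop :=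
  (forall x, differentiable phi x) /\ continuous (gradient phi).

(* Functions on the torus R^n / Z^n are represented by Z^n-periodic functions
   on R^n. *)
Definition torus_periodic (f : 'rV[R]_n -> R) : Prop :=
  forall i : 'I_n, periodic f (delta_mx 0 i).

(* The scalar equation is F(x, u(x), Du(x)) = 0.  The notion is local, so test
   functions on R^n need not be periodic. *)
Definition viscosity_subsolution
    (F : 'rV[R]_n -> R -> 'rV[R]_n -> R) (u : 'rV[R]_n -> R) : Prop :=
  forall (phi : 'rV[R]_n -> R) (x : 'rV[R]_n), C1 phi ->
    (\forall y \near x, u y - phi y <= u x - phi x) ->
    F x (u x) (gradient phi x) <= 0.

Definition viscosity_supersolution
    (F : 'rV[R]_n -> R -> 'rV[R]_n -> R) (u : 'rV[R]_n -> R) : Prop :=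
  forall (phi : 'rV[R]_n -> R) (x : 'rV[R]_n), C1 phi ->
    (\forall y \near x, u x - phi x <= u y - phi y) ->
    0 <= F x (u x) (gradient phi x).

Definition viscosity_solution
    (F : 'rV[R]_n -> R -> 'rV[R]_n -> R) (u : 'rV[R]_n -> R) : Prop :=
  viscosity_subsolution F u /\ viscosity_supersolution F u.

(* H(xi, P + Du) + u - w = c, with the other component w a given function. *)
Definition cell_equation (H : 'rV[R]_n -> 'rV[R]_n -> R) (P : 'rV[R]_n) (c : R)
    (w : 'rV[R]_n -> R) (xi : 'rV[R]_n) (r : R) (p : 'rV[R]_n) : R :=
  H xi (P + p) + r - w xi - c.

Definition cell_problem_solution (H1 H2 : 'rV[R]_n -> 'rV[R]_n -> R)
    (P : 'rV[R]_n) (c : R) (v1 v2 : 'rV[R]_n -> R) : Prop :=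
  [/\ continuous v1 /\ torus_periodic v1,
      continuous v2 /\ torus_periodic v2,
      viscosity_solution (cell_equation H1 P c v2) v1
    & viscosity_solution (cell_equation H2 P c v1) v2].

Definition cell_problem_solvable (H1 H2 : 'rV[R]_n -> 'rV[R]_n -> R)
    (P : 'rV[R]_n) (c : R) : Prop :=
  exists v1 v2 : 'rV[R]_n -> R, cell_problem_solution H1 H2 P c v1 v2.

Definition effective_hamiltonian (H1 H2 : 'rV[R]_n -> 'rV[R]_n -> R)
    (Hbar : 'rV[R]_n -> R) : Prop :=
  forall P : 'rV[R]_n, unique (cell_problem_solvable H1 H2 P) (Hbar P).

End WeaklyCoupledCellProblem.

(* Main.v *)
Require Import Defs.
From HB Require Import structures.
From mathcomp Require Import all_boot all_order all_algebra.
From mathcomp Require Import all_classical all_reals all_analysis.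
From mathcomp Require Import ring lra.
Set Implicit Arguments.
Unset Strict Implicit.
Unset Printing Implicit Defensive.
Import Order.TTheory GRing.Theory Num.Theory.
Import numFieldNormedType.Exports.
Local Open Scope classical_set_scope.
Local Open Scope ring_scope.

(** At the common zero y0 of V1 and V2 the two subsolution inequalities read
    v1 - v2 <= Hbar P and v2 - v1 <= Hbar P, whence Hbar P >= 0.  They may be
    evaluated at y0 because the points where a continuous function is touched
    from above by a C1 function are dense.  For Hbar P <= 0 it suffices, by
    comparison at a global minimum of v_i - psi_i, to exhibit a C1 periodic pair
    (psi1, psi2) satisfying the cell inequalities with right-hand side 0.  Take
    psi1(x) = f1(x_1) + f2(x_2) and psi2(x) = psi1(x) - a1(x_1) + a2(x_2), where
    0 <= 2 a_i <= V_i and a_i vanishes near the zeros of V_i; the inequalities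
    then reduce to (P_i + f_i')^2 <= a_i and (P_i + f_i' -+ a_i')^2 <= a_i.  For
    small P_i they hold if f_i' = -P_i on the zero set of a_i, which is possible
    for a periodic f_i. *)

(** * Derivatives from second-order error bounds *)

Section RealLine.
Context {R : realType}.
Implicit Types (f : R -> R) (x t : R).

(** Serves for functions with a kink in the derivative, where differentiation rules would need a
    separate argument at the kink. *)
Lemma is_derive_quadratic_error f x l C :
  (forall h, `|f (h + x) - f x - h * l| <= C * h ^+ 2) -> is_derive x 1 f l.
Proof.
move=> H.
have C0 : 0 <= C by have := le_trans (normr_ge0 _) (H 1); rewrite expr1n mulr1.
have cf : h^-1 *: ((f \o shift x) (h *: 1) - f x) @[h --> 0^'] --> l.
  apply/cvgrPdist_le => e e0.
  (* [C] may be 0, hence the division by [C + 1]. *)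
  have d0 : 0 < e / (C + 1) by rewrite divr_gt0// ltr_wpDl.
  near=> h.
  have h0 : h != 0 by near: h; exact: nbhs_dnbhs_neq.
  rewrite /= /GRing.scale/= mulr1.
  rewrite -[X in X - _](mulKf h0) -mulrBr normrM normfV distrC.
  rewrite ler_pdivrMl ?normr_gt0//.
  apply: (le_trans (H h)).
  rewrite -real_normK ?num_real// expr2 mulrCA ler_wpM2l//.
  have : `|h| < e / (C + 1).
    near: h; apply: dnbhs0_lt; exact: d0.
  rewrite ltr_pdivlMr ?ltr_wpDl// mulrDr mulr1 => /ltW; apply: le_trans.
  by rewrite mulrC lerDl.
by apply: DeriveDef; [apply/cvg_ex; exists l | exact: cvg_lim cf].
Unshelve. all: by end_near.
Qed.

Lemma is_derive_sqr_pos_part x :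
  is_derive x 1 (fun t : R => Num.max 0 t ^+ 2) (2 * Num.max 0 x).
Proof.
apply: (@is_derive_quadratic_error _ _ _ 1) => h.
rewrite ler_norml; case: (leP 0 x) => hx; case: (leP 0 (h + x)) => hhx.
- nra.
- nra.
- nra.
- nra.
Qed.

(** * A periodic angle with slope 1 on a half circle *)

Definition neg_cos t : R := Num.max 0 (- cos t).

Definition angle_den t : R := 1 + cos t + neg_cos t ^+ 2.

(* Where [cos t >= 0] this is [2 * atan (sin t / (1 + cos t))], i.e. [t] modulo
   [2 pi], so it has slope 1 there; the correction [neg_cos t ^+ 2] only removes
   the jump at [pi], so that the function is C1 and periodic. *)
Definition flat_angle t : R := 2 * atan (sin t * (angle_den t)^-1).

(** The amount by which the slope of [flat_angle] falls short of 1. The factor [neg_cos t] makes it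
    vanish on the half circle where [cos t >= 0]. *)
Definition angle_defect t : R :=
  neg_cos t * (2 * neg_cos t + neg_cos t ^+ 3 + 4 * sin t ^+ 2)
  / (angle_den t ^+ 2 + sin t ^+ 2).

Lemma neg_cos_ge0 t : 0 <= neg_cos t.
Proof. by rewrite /neg_cos le_max lexx. Qed.

Lemma neg_cos_le1 t : neg_cos t <= 1.
Proof. by rewrite /neg_cos ge_max ler01 lerNl cos_geN1. Qed.

(** Where [cos t] is negative the denominator is [1 + cos t + cos t ^+ 2], which is
    [(cos t + 1 / 2) ^+ 2 + 3 / 4]. *)
Lemma angle_den_ge t : 3 / 4 <= angle_den t.
Proof.
rewrite /angle_den /neg_cos; have := cos_geN1 t; have := cos_le1 t.
have := sqr_ge0 (cos t + 1 / 2).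
by case: (leP 0 (- cos t)) => c0; nra.
Qed.

Lemma is_derive_neg_cos_sqr t :
  is_derive t 1 (fun u => neg_cos u ^+ 2) (2 * neg_cos t * sin t).
Proof.
have c : is_derive t 1 (fun u : R => - cos u) (sin t).
  by apply: is_derive_eq; rewrite opprK.
exact: (@is_derive1_comp _ (fun u => Num.max 0 u ^+ 2) (fun u => - cos u) _ _ _
  (is_derive_sqr_pos_part (- cos t)) c).
Qed.

Lemma is_derive_angle_den t :
  is_derive t 1 angle_den (- sin t + 2 * neg_cos t * sin t).
Proof.
have c : is_derive t 1 (fun u : R => 1 + cos u) (- sin t).
  have := is_deriveD (is_derive_cst (1 : R) t 1) (is_derive_cos t).
  by rewrite add0r.
exact: (is_deriveD c (is_derive_neg_cos_sqr t)).
Qed.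

Lemma is_derive_flat_angle t : is_derive t 1 flat_angle (1 - angle_defect t).
Proof.
have D0 : 0 < angle_den t by apply: lt_le_trans (angle_den_ge t); lra.
have dq := is_deriveM (is_derive_sin t)
  (is_deriveV (lt0r_neq0 D0) (is_derive_angle_den t)).
have := @is_derive1_comp _ atan (fun u => sin u * (angle_den u)^-1) _ _ _
  (is_derive1_atan (sin t * (angle_den t)^-1)) dq.
have c2 : is_derive t 1 (cst (2 : R)) (0 : R) by exact: is_derive_cst.
move=> /(is_deriveM c2); move=> dl.
apply: (is_derive_eq dl); move: {dl dq c2} D0 => D0.
rewrite /GRing.scale/= mulr0 addr0 /angle_defect.
have N0 : angle_den t ^+ 2 + sin t ^+ 2 != 0.
  by rewrite gt_eqF// ltr_pwDl ?sqr_ge0// exprn_gt0.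
set s := sin t in N0 *; set D := angle_den t in D0 N0 *.
have DE : D = 1 + cos t + neg_cos t ^+ 2 by [].
have s2 := cos2Dsin2 t; rewrite -/s in s2.
set c := cos t in DE s2 *; set m := neg_cos t in DE *.
have Dn : D != 0 by rewrite gt_eqF.
clearbody D s c m.
(* With denominators cleared, the chain rule leaves a polynomial identity. *)
suff : 2 * (c * D - s * (- s + 2 * m * s)) =
       D ^+ 2 + s ^+ 2 - m * (2 * m + m ^+ 3 + 4 * s ^+ 2).
  move=> E.
  have -> : 1 - m * (2 * m + m ^+ 3 + 4 * s ^+ 2) / (D ^+ 2 + s ^+ 2) =
    (D ^+ 2 + s ^+ 2 - m * (2 * m + m ^+ 3 + 4 * s ^+ 2)) / (D ^+ 2 + s ^+ 2).
    by field.
  have F (a b : R) :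
      2 * ((1 + (s / D) ^+ 2)^-1 * (s * (- D ^- 2 * a) + D^-1 * b)) =
      2 * (b * D - s * a) / (D ^+ 2 + s ^+ 2).
    by field; rewrite Dn N0 //=.
  by rewrite -E; exact: F.
rewrite DE; apply/eqP; rewrite -subr_eq0; apply/eqP.
(* The two sides differ by exactly this expression, so [ring] can conclude. *)
have -> : 0 = c ^+ 2 + s ^+ 2 - 1 by rewrite s2 subrr.
by ring.
Qed.

(** The second factor of the numerator is at most 2 + 1 + 4 = 7 and the denominator at least 9/16;
    13 is 7 * 16/9 rounded up. *)
Lemma angle_defect_le t : `|angle_defect t| <= 13 * neg_cos t.
Proof.
have D34 := angle_den_ge t; have m0 := neg_cos_ge0 t; have m1 := neg_cos_le1 t.
have s2 : sin t ^+ 2 <= 1 by have := cos2Dsin2 t; have := sqr_ge0 (cos t); lra.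
have sge0 := sqr_ge0 (sin t).
have N916 : 9 / 16 <= angle_den t ^+ 2 + sin t ^+ 2 by nra.
have N0 : 0 < angle_den t ^+ 2 + sin t ^+ 2 by lra.
have m3 : 0 <= neg_cos t ^+ 3 <= 1 by rewrite exprn_ge0 ?exprn_ile1.
rewrite /angle_defect ger0_norm; last first.
  by rewrite divr_ge0 ?(ltW N0)// mulr_ge0//; lra.
rewrite ler_pdivrMr// mulrAC [leRHS]mulrC ler_wpM2l//.
lra.
Qed.

Lemma continuous_neg_cos : continuous neg_cos.
Proof.
move=> t; apply: (@continuous_max _ _ (cst 0) (fun u => - cos u)).
  exact: cvg_cst.
by apply: cvgN; exact: continuous_cos.
Qed.

Lemma continuous_angle_defect : continuous angle_defect.
Proof.
move=> t; have cm := @continuous_neg_cos t; have cs := @continuous_sin R t.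
have cX n : neg_cos x ^+ n @[x --> t] --> neg_cos t ^+ n.
  exact: (cvg_comp _ _ cm (@exprn_continuous R n (neg_cos t))).
have cs2 : sin x ^+ 2 @[x --> t] --> sin t ^+ 2.
  exact: (cvg_comp _ _ cs (@exprn_continuous R 2 (sin t))).
have cD : angle_den x @[x --> t] --> angle_den t.
  by apply: cvgD (cX 2%N); apply: cvgD; [exact: cvg_cst|exact: continuous_cos].
have D0 : 0 < angle_den t by apply: lt_le_trans (angle_den_ge t); lra.
apply: cvgM.
  apply: cvgM => //; apply: cvgD; last by apply: cvgM => //; exact: cvg_cst.
  by apply: cvgD => //; apply: cvgM => //; exact: cvg_cst.
apply: cvgV; first by rewrite gt_eqF// ltr_pwDl ?sqr_ge0// exprn_gt0.
apply: cvgD => //.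
exact: (cvg_comp _ _ cD (@exprn_continuous R 2 (angle_den t))).
Qed.

Lemma neg_cosD2pi : periodic neg_cos (pi *+ 2).
Proof. by move=> t; rewrite /neg_cos cosD2pi. Qed.

Lemma flat_angleD2pi : periodic flat_angle (pi *+ 2).
Proof.
by move=> t; rewrite /flat_angle /angle_den neg_cosD2pi cosD2pi sinD2pi.
Qed.

(** * Periodic C1 functions of one variable *)

Lemma periodicz (U V : zmodType) (f : U -> V) (T : U) :
  periodic f T -> forall (k : int) a, f (a + T *~ k) = f a.
Proof.
move=> fT [] k a; first exact: periodicn.
by rewrite NegzE -[in RHS](subrK (T *+ k.+1) a) (periodicn fT) mulrNz.
Qed.

Lemma periodic1_gt0_bound f : continuous f -> periodic f 1 ->
  (forall x, 0 < f x) -> exists2 mu : R, 0 < mu & forall x, mu <= f x.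
Proof.
move=> cf pf f0.
have [c _ cmin] := @EVT_min R f 0 1 ler01 (continuous_subspaceT cf).
exists (f c) => // x.
rewrite -[x](subrK (Num.floor x)%:~R) periodicz// cmin//.
have /andP[h1 h2] := floor_itv x.
by rewrite in_itv/= subr_ge0 h1 lerBlDr ltW// (lt_le_trans h2)// intrD addrC.
Qed.

Definition periodic_C1 (f f' : R -> R) : Prop :=
  [/\ periodic f 1, forall t, is_derive t 1 f (f' t) & continuous f'].

(** Passes from functions of an angle to functions of period 1, with angle 0 placed at [y0]. *)
Lemma periodic_C1_rescale (F G : R -> R) y0 : periodic F (pi *+ 2) ->
  (forall t, is_derive t 1 F (G t)) -> continuous G ->
  periodic_C1 (fun t => F (pi *+ 2 * (t - y0)))
              (fun t => pi *+ 2 * G (pi *+ 2 * (t - y0))).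
Proof.
move=> pF dF cG; have ca : continuous (fun t : R => pi *+ 2 * (t - y0)).
  move=> t; apply: cvgM; first exact: cvg_cst.
  by apply: cvgB => //; exact: cvg_cst.
split=> [t|t|t].
- by rewrite addrAC mulrDr mulr1 pF.
- have da : is_derive t 1 (fun t : R => pi *+ 2 * (t - y0)) (pi *+ 2).
    have := is_deriveM (is_derive_cst (pi *+ 2 : R) t 1)
      (is_deriveB (is_derive_id t 1) (is_derive_cst y0 t 1)).
    by rewrite /GRing.scale/= subr0 mulr1 mulr0 addr0.
  have := @is_derive1_comp _ F (fun t => pi *+ 2 * (t - y0)) _ _ _ (dF _) da.
  by rewrite mulrC.
- apply: cvgM; first exact: cvg_cst.
  by apply: (@continuous_comp _ _ _ (fun t : R => pi *+ 2 * (t - y0)) G);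
    [exact: ca|exact: cG].
Qed.

Lemma periodic_C1_scale k f f' :
  periodic_C1 f f' -> periodic_C1 (fun t => k * f t) (fun t => k * f' t).
Proof.
case=> pf df cf; split=> [t|t|t]; first by rewrite pf.
  have := is_deriveM (is_derive_cst k t 1) (df t).
  by rewrite /GRing.scale/= mulr0 addr0.
by apply: cvgM; [exact: cvg_cst|exact: cf].
Qed.

Lemma periodic_C1D f f' g g' : periodic_C1 f f' -> periodic_C1 g g' ->
  periodic_C1 (fun t => f t + g t) (fun t => f' t + g' t).
Proof.
case=> pf df cf [pg dg cg]; split=> [t|t|t]; first by rewrite pf pg.
  exact: is_deriveD (df t) (dg t).
by apply: cvgD; [exact: cf|exact: cg].
Qed.

(** With [m] the negative part of the cosine of the angle around [y0], take [a] a small multiple of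
    [m ^+ 2] and [f] a multiple of [flat_angle]. Then [p + f'] and [a'] are both small multiples of
    [m], so their squares are dominated by [a]. *)
Lemma flat_profile (V : R -> R) y0 : continuous V -> periodic V 1 ->
  (forall x, 0 <= V x) -> (forall x, V x = 0 -> x - y0 \is a Num.int) ->
  exists (a a' : R -> R) (gamma : R),
    [/\ periodic_C1 a a', forall t, 2 * a t <= V t, 0 < gamma &
    forall p, `|p| <= gamma -> exists f f', periodic_C1 f f' /\
      forall t, [/\ (p + f' t) ^+ 2 <= a t, (p + (f' t + a' t)) ^+ 2 <= a t &
                    (p + (f' t - a' t)) ^+ 2 <= a t]].
Proof.
move=> cV pV V0 Vint.
pose w : R := pi *+ 2; pose th t := w * (t - y0).
have w0 : 0 < w by rewrite mulrn_wgt0// pi_gt0.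
have cth : continuous th.
  move=> t; apply: cvgM; first exact: cvg_cst.
  by apply: cvgB => //; exact: cvg_cst.
(* At a zero of [V] the cosine is 1, so the sum never vanishes; its lower bound [mu] then bounds [V]
   wherever the cosine is nonpositive. *)
have [mu mu0 mule] : exists2 mu : R, 0 < mu &
    forall x, mu <= V x + Num.max 0 (cos (th x)).
  apply: periodic1_gt0_bound.
  - move=> x; apply: cvgD; first exact: cV.
    apply: (@continuous_max _ _ (cst 0) (fun x => cos (th x))).
      exact: cvg_cst.
    apply: (@continuous_comp _ _ _ th cos); first exact: cth.
    exact: continuous_cos.
  - by move=> x; rewrite pV /th addrAC mulrDr mulr1 cosD2pi.
  - move=> x; have := V0 x; rewrite le_eqVlt => /predU1P[Vx0|Vx0].
      rewrite -Vx0 add0r; have /intrP[k xk] := Vint x (esym Vx0).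
      rewrite /th xk -[w * _]add0r mulrzr (periodicz (@cosD2pi R)) cos0.
      by rewrite lt_max ltr01 orbT.
    by rewrite ltr_pwDl// le_max lexx.
pose m t := neg_cos (th t).
have m0 t : 0 <= m t by exact: neg_cos_ge0.
have m1 t : m t <= 1 by exact: neg_cos_le1.
have mV t : mu * m t ^+ 2 <= V t.
  have := mule t; have := m1 t; have := m0 t; rewrite /m /neg_cos.
  case: (leP 0 (- cos (th t))) => c0; last by rewrite expr0n mulr0.
  case: (leP 0 (cos (th t))) => c1 h0 h1 h2.
    have -> : cos (th t) = 0 by lra.
    by rewrite oppr0 expr0n mulr0.
  rewrite addr0 in h2; apply: le_trans h2; rewrite ler_piMr ?(ltW mu0)//.
(* The first upper bound on [eps] yields [2 * a t <= V t], the second [(2 * a' t) ^+ 2 <= a t]. *)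
have [eps [eps0 epsmu epsw]] :
    exists eps : R, [/\ 0 < eps, 2 * eps <= mu & 16 * w ^+ 2 * eps <= 1].
  exists (Num.min (mu / 2) (16 * w ^+ 2)^-1).
  have W0 : 0 < 16 * w ^+ 2 by rewrite mulr_gt0// exprn_gt0.
  rewrite lt_min divr_gt0// invr_gt0 W0; split=> //.
    by rewrite mulrC -ler_pdivlMr// ge_min lexx.
  by rewrite mulrC -ler_pdivlMr// div1r ge_min lexx orbT.
pose a t := eps * m t ^+ 2.
pose a' t := eps * (w * (2 * m t * sin (th t))).
(* Here 26 is twice the constant 13 of [angle_defect_le]. *)
exists a, a', (Num.sqrt eps / 26); split.
- apply: periodic_C1_scale.
  apply: (@periodic_C1_rescale (fun t => neg_cos t ^+ 2)
    (fun t => 2 * neg_cos t * sin t)).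
  + by move=> t; rewrite neg_cosD2pi.
  + exact: is_derive_neg_cos_sqr.
  + move=> t; apply: cvgM; last exact: continuous_sin.
    by apply: cvgM; [exact: cvg_cst|exact: continuous_neg_cos].
- move=> t; rewrite /a mulrA; apply: le_trans (mV t).
  by rewrite ler_wpM2r// sqr_ge0.
- by rewrite divr_gt0// sqrtr_gt0.
move=> p pg.
(* The slope is [- p] up to the defect, so that [p + f' t] is [p * angle_defect (th t)]. *)
exists (fun t => - (p / w) * flat_angle (th t)),
  (fun t => - (p / w) * (w * (1 - angle_defect (th t)))); split.
  apply: periodic_C1_scale.
  apply: (@periodic_C1_rescale flat_angle (fun t => 1 - angle_defect t)).
  - exact: flat_angleD2pi.
  - exact: is_derive_flat_angle.
  - move=> t; apply: cvgB; first exact: cvg_cst.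
    exact: continuous_angle_defect.
move=> t.
have qE : p + - (p / w) * (w * (1 - angle_defect (th t))) =
          p * angle_defect (th t).
  by rewrite mulrA mulNr divfK ?gt_eqF//; ring.
rewrite addrA addrA qE.
have qle : (2 * (p * angle_defect (th t))) ^+ 2 <= a t.
  have gE : (26 * (Num.sqrt eps / 26)) ^+ 2 = eps.
    by rewrite mulrC divfK// sqr_sqrtr// ltW.
  have : `|2 * (p * angle_defect (th t))| <=
         26 * (Num.sqrt eps / 26) * m t.
    rewrite normrM normrM ger0_norm//.
    have := ler_pM (normr_ge0 _) (normr_ge0 _) pg (angle_defect_le (th t)).
    by rewrite -/(m t); lra.
  rewrite -real_normK ?num_real// -(ler_pXn2r (ltn0Sn 1)) ?nnegrE//; last first.
    by rewrite !mulr_ge0 ?sqrtr_ge0.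
  by rewrite exprMn gE.
have dle : (2 * a' t) ^+ 2 <= a t.
  have s2 : sin (th t) ^+ 2 <= 1.
    by have := cos2Dsin2 (th t); have := sqr_ge0 (cos (th t)); lra.
  have -> : (2 * a' t) ^+ 2 = a t * (16 * w ^+ 2 * eps) * sin (th t) ^+ 2.
    by rewrite /a' /a; ring.
  have a0 : 0 <= a t by rewrite mulr_ge0 ?sqr_ge0// ltW.
  have e0 : 0 <= 16 * w ^+ 2 * eps.
    by rewrite mulr_ge0 ?ltW// mulr_gt0// exprn_gt0.
  apply: le_trans (_ : a t * (16 * w ^+ 2 * eps) <= _).
    by rewrite ler_piMr// mulr_ge0.
  by rewrite ler_piMr.
(* The factors 2 leave room for the cross term: [(q + d) ^+ 2] and [(q - d) ^+ 2] are at most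
   [2 * q ^+ 2 + 2 * d ^+ 2], hence at most [a t]. *)
move: qle dle; set q := p * _; set d := a' t => qle dle.
rewrite !expr2 in qle dle *.
have := sqr_ge0 (q - d); have := sqr_ge0 (q + d); have := sqr_ge0 q.
rewrite !expr2.
by split; nra.
Qed.

End RealLine.

(** * Separable C1 functions and touching points in several variables *)

Section CellProblem.
Context {R : realType} {n : nat}.
Implicit Types (f : 'I_n -> R -> R) (x : 'rV[R]_n).

Definition separable f x : R := \sum_(i < n) f i (x 0 i).

Lemma is_derive_coord (g : R -> R) (l : R) (i j : 'I_n) x :
  is_derive (x 0 i) 1 g l ->
  is_derive x (delta_mx 0 j) (fun y => g (y 0 i)) (l *+ (i == j)).
Proof.
move=> [dg gl].
pose gi (y : 'rV[R]_n) := g (y 0 i).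
have E : (fun h : R => h^-1 *: ((gi \o shift x) (h *: delta_mx 0 j) - gi x)) =
    fun h => (h^-1 *: ((g \o shift (x 0 i)) (h *: 1) - g (x 0 i))) *+ (i == j).
  apply/funext => h; rewrite /gi /= !mxE eqxx /= [h *: 1]mulr1.
  by case: eqVneq => [->|ij]; rewrite ?mulr1// mulr0 add0r subrr scaler0.
have cE : h^-1 *: ((gi \o shift x) (h *: delta_mx 0 j) - gi x) @[h --> 0^']
    --> l *+ (i == j).
  rewrite E; case: (i == j); last exact: cvg_cst.
  by rewrite -gl; exact: dg.
by apply: DeriveDef; [apply/cvg_ex; exists (l *+ (i == j))|exact: cvg_lim cE].
Qed.

Lemma C1_separable f f' : (forall i (t : R), is_derive t 1 (f i) (f' i t)) ->
  (forall i, continuous (f' i)) ->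
  C1 (separable f) /\
  forall x, gradient (separable f) x = \row_i f' i (x 0 i).
Proof.
move=> df cf.
have sE : separable f = \sum_(i < n) (fun x => f i (x 0 i)).
  by apply/funext => x; rewrite fct_sumE.
have gE x : gradient (separable f) x = \row_i f' i (x 0 i).
  apply/rowP => j; rewrite !mxE sE.
  have D := is_derive_sum (fun i => @is_derive_coord _ _ i j x (df i (x 0 i))).
  rewrite (@derive_val _ _ _ _ _ _ _ D).
  by rewrite (bigD1 j)//= eqxx mulr1n big1 ?addr0// => i /negPf ->.
split=> //; split=> [x|].
  rewrite sE; apply: differentiable_sum => i.
  apply: (@differentiable_comp _ _ _ _ (fun y : 'rV_n => y 0 i) (f i)).
    exact: differentiable_coord.
  by apply/derivable1_diffP; exact: ex_derive.
(* Expansion in the standard basis reduces continuity of the gradient to its scalar coefficients. *)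
rewrite (_ : gradient _ = fun x => \sum_(i < n) f' i (x 0 i) *: delta_mx 0 i).
  apply: continuous_big => [z|i _].
    by apply: cvgD; [exact: cvg_fst|exact: cvg_snd].
  have cfi : continuous (fun x : 'rV[R]_n => f' i (x 0 i)).
    move=> x; apply: (@continuous_comp _ _ _ (fun y : 'rV_n => y 0 i) (f' i)).
      exact: coord_continuous.
    exact: cf.
  by move=> x; exact: cvgZ (cfi x) (cvg_cst _).
apply/funext => x; rewrite gE [LHS]row_sum_delta.
by apply: eq_bigr => i _; rewrite mxE.
Qed.

Lemma compact_box (a b : 'I_n -> R) :
  compact [set x : 'rV[R]_n | forall i, a i <= x 0 i <= b i].
Proof.
have := @rV_compact R n (fun i => `[a i, b i]%classic)
  (fun i => @segment_compact R (a i) (b i)).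
congr compact; apply/seteqP; split=> x /= h i; have := h i; rewrite in_itv/=;
  by rewrite [ord0](ord1 0).
Qed.

(** Were [w] positive at [x0], it would be so on a small box around [x0]. Over that box [u] minus a
    steep paraboloid attains its maximum at an interior point, which is a touching point, and there
    [w] is nonpositive. *)
Lemma le0_of_touching (u w : 'rV[R]_n -> R) : continuous u -> continuous w ->
  (forall phi x, C1 phi -> (\forall y \near x, u y - phi y <= u x - phi x) ->
    w x <= 0) ->
  forall x, w x <= 0.
Proof.
move=> cu cw touch x0; rewrite leNgt; apply/negP => w0.
have [e /= e0 ball_w] : nbhs_ball x0 [set x | 0 < w x].
  by apply/nbhs_ballP; exact: (cvgr_gt _ (cw x0)).
(* Balls of the sup norm are boxes, so half the radius keeps the closed box [K] inside the open ball
   where [w] is positive. *)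
pose r := e / 2; have r0 : 0 < r by rewrite divr_gt0.
pose K := [set x : 'rV[R]_n | forall i, x0 0 i - r <= x 0 i <= x0 0 i + r].
have Kx0 : K x0 by move=> i; apply/andP; split; lra.
have cK : compact K by exact: compact_box.
have [zM _ uM] := @EVT_max_rV R n u K (ex_intro _ x0 Kx0) cK
  (continuous_subspaceT cu).
(* This penalty is so large that [u - phi] is below [u x0] on the boundary of
   [K], which forces its maximum over [K] to be interior. *)
pose k := (u zM - u x0 + 1) / r ^+ 2.
have ux0M : u x0 <= u zM by apply: uM; rewrite inE.
have k0 : 0 <= k by rewrite divr_ge0 ?sqr_ge0//; lra.
pose phi := separable (fun i t => k * (t - x0 0 i) ^+ 2).
have [C1phi _] : C1 phi /\ forall x, gradient phi x =
    \row_i ((fun i t => k * (2 * (t - x0 0 i))) i (x 0 i)).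
  apply: (@C1_separable (fun i t => k * (t - x0 0 i) ^+ 2)
    (fun i t => k * (2 * (t - x0 0 i)))) => [i t|i t].
    apply: (@is_derive_quadratic_error _ _ _ _ k) => h.
    rewrite (_ : _ - _ - _ = k * h ^+ 2); last by ring.
    by rewrite ger0_norm// mulr_ge0// sqr_ge0.
  apply: cvgM; first exact: cvg_cst.
  apply: cvgM; first exact: cvg_cst.
  by apply: cvgB => //; exact: cvg_cst.
have cphi : continuous phi.
  by move=> x; apply: differentiable_continuous; exact: C1phi.1.
have cuphi : continuous (fun x => u x - phi x).
  by move=> x; exact: cvgB (cu x) (cphi x).
have [z /set_mem Kz zmax] := @EVT_max_rV R n (fun x => u x - phi x) K
  (ex_intro _ x0 Kx0) cK (continuous_subspaceT cuphi).
have zin i : x0 0 i - r < z 0 i < x0 0 i + r.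
  rewrite -ltr_distl ltNge; apply/negP => zr.
  have phiz : k * r ^+ 2 <= phi z.
    rewrite /phi /separable (bigD1 i)//= ler_wpDr//.
      by apply: sumr_ge0 => j _; rewrite mulr_ge0// sqr_ge0.
    apply: ler_wpM2l => //.
    by rewrite -[leRHS]real_normK ?num_real// ler_pXn2r ?nnegrE// ltW.
  have phi0 : phi x0 = 0.
    by rewrite /phi /separable big1// => j _; rewrite subrr expr0n mulr0.
  have kr : k * r ^+ 2 = u zM - u x0 + 1 by rewrite divfK// gt_eqF// exprn_gt0.
  have := zmax x0 (mem_set Kx0); have := uM z (mem_set Kz).
  rewrite phi0; lra.
have : w z <= 0.
  apply: (touch phi) => //.
  have : \forall y \near z, forall i : 'I_n,
      x0 0 i - r < (y : 'rV[R]_n) 0 i < x0 0 i + r.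
    apply: (@filter_forall _ _ (fun (i : 'I_n) (y : 'rV[R]_n) =>
      x0 0 i - r < y 0 i < x0 0 i + r) (nbhs z)) => i.
    have /andP[z1 z2] := zin i.
    have ci : (fun y : 'rV[R]_n => y 0 i) y @[y --> z] --> z 0 i.
      exact: coord_continuous.
    near=> y; apply/andP; split; near: y.
      exact: (cvgr_gt _ ci).
    exact: (cvgr_lt _ ci).
  apply: filterS => y Hy; apply: zmax; apply/mem_set => i.
  by have /andP[/ltW -> /ltW ->] := Hy i.
rewrite leNgt => /negP; apply; apply: ball_w.
split=> // i j; rewrite ord1 /ball/= distrC.
have := zin j; rewrite -ltr_distl => /lt_trans; apply.
by rewrite /r; lra.
Unshelve. all: by end_near.
Qed.

(** * Minima on the torus and bounds for the cell problem *)

Lemma torus_periodic_sum (f : 'rV[R]_n -> R) (s : seq 'I_n)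
    (k : 'I_n -> int) x :
  torus_periodic f -> f (x + \sum_(i <- s) (k i)%:~R *: delta_mx 0 i) = f x.
Proof.
move=> pf; elim: s => [|i s IH]; first by rewrite big_nil addr0.
by rewrite big_cons scaler_int [_ *~ _ + _]addrC addrA (periodicz (pf i)).
Qed.

Lemma torus_periodic_min (f : 'rV[R]_n -> R) : continuous f ->
  torus_periodic f -> exists x, forall y, f x <= f y.
Proof.
move=> cf pf.
pose K := [set x : 'rV[R]_n | forall i, 0 <= x 0 i <= 1].
have K0 : K 0 by move=> i; rewrite mxE lexx ler01.
have [x _ xmin] := @EVT_min_rV R n f K (ex_intro _ 0 K0)
  (@compact_box (fun=> 0) (fun=> 1)) (continuous_subspaceT cf).
exists x => y.
(* This integer translation brings [y] into the unit cube. *)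
pose k i := - Num.floor (y 0 i).
rewrite -(torus_periodic_sum (index_enum 'I_n) k y pf).
apply: xmin; apply/mem_set => i.
rewrite mxE summxE (bigD1 i)//= big1 ?addr0 => [|j ji]; last first.
  by rewrite !mxE [i == j]eq_sym (negPf ji) andbF mulr0.
have /andP[h1 h2] := floor_itv (y 0 i).
rewrite intrD in h2; rewrite !mxE !eqxx mulr1 /k mulrNz.
by apply/andP; split; lra.
Qed.

(** Test the component whose difference [v - psi] has the smaller minimum. If it is the first, then
    [v1 - v2 <= psi1 - psi2] at the minimum point, so the supersolution inequality for [v1] and the
    inequality for [psi1] give [c <= d]. *)
Lemma cell_problem_le (H1 H2 : 'rV[R]_n -> 'rV[R]_n -> R) P (c d : R)
    (v1 v2 psi1 psi2 : 'rV[R]_n -> R) :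
  cell_problem_solution H1 H2 P c v1 v2 ->
  C1 psi1 -> torus_periodic psi1 -> C1 psi2 -> torus_periodic psi2 ->
  (forall x, H1 x (P + gradient psi1 x) + psi1 x - psi2 x <= d) ->
  (forall x, H2 x (P + gradient psi2 x) + psi2 x - psi1 x <= d) ->
  c <= d.
Proof.
move=> [[cv1 pv1] [cv2 pv2] [_ sup1] [_ sup2]].
move=> C1psi1 ppsi1 C1psi2 ppsi2 sub1 sub2.
have minB (v psi : 'rV[R]_n -> R) : continuous v -> torus_periodic v ->
    C1 psi -> torus_periodic psi ->
    exists x, forall y, v x - psi x <= v y - psi y.
  move=> cv pv [dpsi _] ppsi.
  apply: (torus_periodic_min (f := fun x => v x - psi x)).
    by move=> x; exact: cvgB (cv x) (differentiable_continuous (dpsi x)).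
  by move=> i x; rewrite pv ppsi.
have [x1 min1] := minB _ _ cv1 pv1 C1psi1 ppsi1.
have [x2 min2] := minB _ _ cv2 pv2 C1psi2 ppsi2.
have [le12|/ltW le21] := leP (v1 x1 - psi1 x1) (v2 x2 - psi2 x2).
  have := sup1 psi1 x1 C1psi1 (filterE (nbhs_filter x1) min1).
  rewrite /cell_equation.
  have := sub1 x1; have := min2 x1; lra.
have := sup2 psi2 x2 C1psi2 (filterE (nbhs_filter x2) min2).
rewrite /cell_equation.
by have := sub2 x2; have := min1 x2; lra.
Qed.

(** At touching points of [v] the lower bound on [H] removes the gradient from the subsolution
    inequality. What remains involves continuous functions only and extends to every point. *)
Lemma cell_subsolution_diff_le (H : 'rV[R]_n -> 'rV[R]_n -> R) P c
    (v w h : 'rV[R]_n -> R) :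
  continuous v -> continuous w -> continuous h ->
  (forall x p, - h x <= H x p) ->
  viscosity_subsolution (cell_equation H P c w) v ->
  forall x, v x - w x <= c + h x.
Proof.
move=> cv cw ch Hh sub x; rewrite -subr_le0.
apply: (le0_of_touching (w := fun x => v x - w x - (c + h x)) cv)
  => [{}x|phi {}x C1phi near_phi].
  exact: cvgB (cvgB (cv x) (cw x)) (cvgD (cvg_cst c) (ch x)).
have := sub phi x C1phi near_phi; rewrite /cell_equation.
by have := Hh x (P + gradient phi x); lra.
Qed.

End CellProblem.

(** * Vanishing of the effective Hamiltonian near the origin *)

Theorem theorem4p20 (R : realType) (V1 V2 : R -> R) (y01 y02 : R)
    (Hbar : 'rV[R]_2 -> R)
    (V1_cont : continuous V1) (V2_cont : continuous V2)
    (V1_per : periodic V1 1) (V2_per : periodic V2 1)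
    (V1_ge0 : forall x, 0 <= V1 x) (V2_ge0 : forall x, 0 <= V2 x)
    (V1_zero : forall x, V1 x = 0 <-> x - y01 \is a Num.int)
    (V2_zero : forall x, V2 x = 0 <-> x - y02 \is a Num.int)
    (Hbar_eff : effective_hamiltonian
       (fun xi p : 'rV[R]_2 => enorm p ^+ 2 - V1 (xi 0 0))
       (fun xi p : 'rV[R]_2 => enorm p ^+ 2 - V2 (xi 0 1)) Hbar) :
  exists2 gamma : R, 0 < gamma &
    forall P : 'rV[R]_2, enorm P <= gamma -> Hbar P = 0.
Proof.
have [a1 [a1' [g1 [C1a1 a1V g1_gt0 prof1]]]] :=
  flat_profile V1_cont V1_per V1_ge0 (fun x => (V1_zero x).1).
have [a2 [a2' [g2 [C1a2 a2V g2_gt0 prof2]]]] :=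
  flat_profile V2_cont V2_per V2_ge0 (fun x => (V2_zero x).1).
exists (Num.min g1 g2); first by rewrite lt_min g1_gt0.
move=> P Pg; have [[v1 [v2 vsol]] _] := Hbar_eff P.
have enormE (p : 'rV[R]_2) : enorm p ^+ 2 = p 0 0 ^+ 2 + p 0 1 ^+ 2.
  rewrite /enorm sqr_sqrtr; last by apply: sumr_ge0 => i _; rewrite sqr_ge0.
  by rewrite big_ord_recl big_ord1; congr (_ + p 0 _ ^+ 2); exact/val_inj.
have coord_le i : `|P 0 i| <= enorm P.
  rewrite -sqrtr_sqr ler_wsqrtr// (bigD1 i)//= lerDl.
  by apply: sumr_ge0 => j _; rewrite sqr_ge0.
have P1 : `|P 0 0| <= g1.
  by rewrite (le_trans (coord_le 0))// (le_trans Pg)// ge_min lexx.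
have P2 : `|P 0 1| <= g2.
  by rewrite (le_trans (coord_le 1))// (le_trans Pg)// ge_min lexx orbT.
have [f1 [f1' [C1f1 hf1]]] := prof1 _ P1.
have [f2 [f2' [C1f2 hf2]]] := prof2 _ P2.
have separable2 (f f' g g' : R -> R) : periodic_C1 f f' -> periodic_C1 g g' ->
    exists psi : 'rV[R]_2 -> R, [/\ C1 psi, torus_periodic psi,
      forall x, psi x = f (x 0 0) + g (x 0 1),
      forall x, gradient psi x 0 0 = f' (x 0 0) &
      forall x, gradient psi x 0 1 = g' (x 0 1)].
  move=> [pf df cf] [pg dg cg].
  pose F (i : 'I_2) := if i == 0 then f else g.
  pose F' (i : 'I_2) := if i == 0 then f' else g'.
  have [C1F gF] : C1 (separable F) /\
      forall x, gradient (separable F) x = \row_i F' i (x 0 i).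
    by apply: C1_separable => i; rewrite /F /F'; case: ifP.
  exists (separable F); split=> //.
  - move=> i x; apply: eq_bigr => j _; rewrite !mxE eqxx /= /F.
    by case: (j == i); case: (j == 0); rewrite ?addr0// ?pf ?pg.
  - move=> x; rewrite /separable big_ord_recl big_ord1 /F /=.
    by congr (_ + g (x 0 _)); exact/val_inj.
  - by move=> x; rewrite gF mxE.
  - by move=> x; rewrite gF mxE.
have [psi1 [C1psi1 ppsi1 psi1E grad10 grad11]] := separable2 _ _ _ _ C1f1 C1f2.
have [psi2 [C1psi2 ppsi2 psi2E grad20 grad21]] := separable2 _ _ _ _
  (periodic_C1D C1f1 (periodic_C1_scale (-1) C1a1)) (periodic_C1D C1f2 C1a2).
apply/eqP; rewrite eq_le; apply/andP; split.
  (* The squared gradient terms are at most [a1 + a2] and [psi1 - psi2] is [a1 - a2]; the left-hand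
     sides are thus at most [2 * a1 - V1] and [2 * a2 - V2]. *)
  apply: (cell_problem_le vsol C1psi1 ppsi1 C1psi2 ppsi2) => x.
    rewrite enormE [(P + _) 0 0]mxE [(P + _) 0 1]mxE grad10 grad11 psi1E psi2E.
    have [q1 _ _] := hf1 (x 0 0); have [q2 _ _] := hf2 (x 0 1).
    have := a1V (x 0 0); lra.
  rewrite enormE [(P + _) 0 0]mxE [(P + _) 0 1]mxE grad20 grad21.
  rewrite psi1E psi2E mulN1r.
  have [_ _ q1] := hf1 (x 0 0); have [_ q2 _] := hf2 (x 0 1).
  have := a2V (x 0 1); lra.
case: vsol => [[cv1 _] [cv2 _] [sub1 _] [sub2 _]].
have coord_cont (V : R -> R) (i : 'I_2) : continuous V ->
    continuous (fun x : 'rV[R]_2 => V (x 0 i)).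
  move=> cV x; apply: (@continuous_comp _ _ _ (fun y : 'rV[R]_2 => y 0 i) V).
    exact: coord_continuous.
  exact: cV.
(* A common zero exists because the two potentials depend on different coordinates. *)
pose x0 : 'rV[R]_2 := \row_i (if i == 0 then y01 else y02).
have V1x0 : V1 (x0 0 0) = 0 by apply/V1_zero; rewrite mxE subrr rpred0.
have V2x0 : V2 (x0 0 1) = 0 by apply/V2_zero; rewrite mxE subrr rpred0.
have H1ge (x p : 'rV[R]_2) : - V1 (x 0 0) <= enorm p ^+ 2 - V1 (x 0 0).
  by rewrite lerDr sqr_ge0.
have H2ge (x p : 'rV[R]_2) : - V2 (x 0 1) <= enorm p ^+ 2 - V2 (x 0 1).
  by rewrite lerDr sqr_ge0.
(* The two bounds at [x0] add up to [0 <= 2 * Hbar P]. *)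
have := cell_subsolution_diff_le cv1 cv2 (coord_cont _ _ V1_cont) H1ge sub1 x0.
have := cell_subsolution_diff_le cv2 cv1 (coord_cont _ _ V2_cont) H2ge sub2 x0.
by rewrite V1x0 V2x0; lra.
Qed.
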